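(* Let $n=2^hp^s$, where $p$ is an odd prime, $h,s\in\mathbb{N}$ and $h>1$. Let $m\in\mathbb{N}\cup\{0\}$ and integers $0=k_0<k_1<\cdots<k_m<s$, and let $S=\{p^{k_0},\ldots,p^{k_m},n-p^{k_0},\ldots,n-p^{k_m}\}\subseteq\mathbb{Z}_n$. Then the circulant graph $\mathrm{Cay}(\mathbb{Z}_n,S)$ does not exhibit PGFR.
   Context: The circulant graph $\mathrm{Cay}(\mathbb{Z}_n,S)$ has vertex set $\mathbb{Z}_n$, two distinct vertices $a,b$ being adjacent iff $b-a\in S$. For a graph $\Gamma$ with adjacency matrix $A$, the transition matrix is $H(t)=\exp(-\mathbf{i}tA)$, $t\in\mathbb{R}$, and $\mathbf{e}_v$ is the standard basis vector of vertex $v$. $\Gamma$ exhibits pretty good fractional revival (PGFR) between distinct vertices $a$ and $b$ if there is a sequence of real numbers $\{t_k\}$ with $\lim_{k\to\infty}H(t_k)\mathbf{e}_a=\alpha\mathbf{e}_a+\beta\mathbf{e}_b$ for some $\alpha,\beta\in\mathbb{C}$ with $\beta\neq0$ and $|\alpha|^2+|\beta|^2=1$; $\Gamma$ exhibits PGFR if it does so between some pair of distinct vertices. *)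

(* Defs.v *)
From HB Require Import structures.
From mathcomp Require Import all_boot all_order all_algebra.
From mathcomp Require Import complex.
From mathcomp Require Import all_classical all_reals all_analysis.
Set Implicit Arguments.
Unset Strict Implicit.
Unset Printing Implicit Defensive.
Import Order.TTheory GRing.Theory Num.Theory.
Import numFieldNormedType.Exports.
Local Open Scope classical_set_scope.
Local Open Scope ring_scope.

(* [R[i]] viewed as a [numClosedFieldType], so that it (and hence matrices over
   it) inherits the topology given by the modulus. *)
Notation Cplx R := (complex R : numClosedFieldType).

Definition expmx (R : realType) (n : nat) (A : 'M[Cplx R]_n.+1) :
    'M[Cplx R]_n.+1 :=
  limn (series (fun k : nat => (k`!%:R : Cplx R)^-1 *: A ^+ k)).

(* Graphs on a nonempty vertex set are given by their adjacency relation. *)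
Definition adjmx (R : realType) (n : nat) (e : rel 'I_n.+1) :
    'M[Cplx R]_n.+1 :=
  \matrix_(a, b) (e a b)%:R.

Definition transition_mx (R : realType) (n : nat) (e : rel 'I_n.+1) (t : R) :
    'M[Cplx R]_n.+1 :=
  expmx ((- ('i%C * t%:C%C) : Cplx R) *: adjmx R e).

Definition vertex_vec (R : realType) (n : nat) (v : 'I_n.+1) :
    'cV[Cplx R]_n.+1 :=
  delta_mx v 0.

Definition PGFR_between (R : realType) (n : nat) (e : rel 'I_n.+1)
    (a b : 'I_n.+1) : Prop :=
  exists (t : nat -> R) (alpha beta : Cplx R),
    [/\ beta != 0,
        `|alpha| ^+ 2 + `|beta| ^+ 2 = 1 &
        (fun k : nat => transition_mx e (t k) *m vertex_vec R a) @ \oo -->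
          alpha *: vertex_vec R a + beta *: vertex_vec R b].

Definition PGFR (R : realType) (n : nat) (e : rel 'I_n.+1) : Prop :=
  exists a b : 'I_n.+1, a != b /\ PGFR_between R e a b.

(* Meaningful for [1 < n]: ['Z_0] and ['Z_1] are both the integers mod 2. *)
Definition circulant (n : nat) (S : {set 'Z_n}) : rel 'Z_n :=
  fun a b => (a != b) && (b - a \in S).

Definition prime_power_connection_set (n p m : nat) (k : 'I_m.+1 -> nat) :
    {set 'Z_n} :=
  ([set ((p ^ k i)%N%:R : 'Z_n) | i : 'I_m.+1]
   :|: [set ((n - p ^ k i)%N%:R : 'Z_n) | i : 'I_m.+1])%SET.

(* Main.v *)
Require Import Defs.
From HB Require Import structures.
From mathcomp Require Import all_boot all_order all_algebra.
From mathcomp Require Import cyclic separable cyclotomic.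
From mathcomp Require Import complex.
From mathcomp Require Import all_classical all_reals all_analysis.
From mathcomp Require Import ring.
Set Implicit Arguments.
Unset Strict Implicit.
Unset Printing Implicit Defensive.
Import Order.TTheory GRing.Theory Num.Theory.
Import numFieldNormedType.Exports.
Local Open Scope classical_set_scope.
Local Open Scope ring_scope.

(* Write [lam l] for the sum of the characters [chi l] over [S], the eigenvalues
   of the graph. Projecting [H(t_k) e_a --> alpha e_a + beta e_b] on the
   eigenvectors gives [exp(-i t_k lam l) --> g l], where
   [g l = alpha + beta * chi l (a - b)], so every integer relation between
   eigenvalues becomes a multiplicative relation between the [g l].
   From [lam (-1) = lam 1] we get [2 (a - b) = 0], so that [g l] only depends
   on the parity of [l]. As [n / 2] is even and every element of [S] is odd,
   [lam (l + n / 2) = - lam l] gives [g l ^ 2 = 1]; as [p ^ s] divides no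
   element of [S], the sum of [lam (l + 2 ^ h r)] over [r < p ^ s] vanishes,
   which gives [g l ^ (p ^ s) = 1]. Hence [g l = 1] for all [l], and [beta = 0]. *)

(** ['X^n - 1] splits and, in characteristic 0, is separable; its [n] distinct roots then include a
    primitive one. *)
Lemma prim_root_exists (C : numClosedFieldType) n :
  (0 < n)%N -> exists z : C, n.-primitive_root z.
Proof.
move=> n_gt0; have [r Dp] := closed_field_poly_normal ('X^n - 1 : {poly C}).
rewrite (monicP _) ?monicXnsubC // scale1r in Dp.
have rn1 : all n.-unity_root r by apply/allP=> z; rewrite -root_prod_XsubC -Dp.
have sz_r : (n < (size r).+1)%N.
  by rewrite -(size_prod_XsubC r id) -Dp size_XnsubC.
have [|z] := hasP (has_prim_root n_gt0 rn1 _ sz_r); last by exists z.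
by rewrite -separable_prod_XsubC -Dp separable_Xn_sub_1 // pnatr_eq0 -lt0n.
Qed.

Lemma norm_prim_root (C : numClosedFieldType) n (z : C) :
  n.-primitive_root z -> `|z| = 1.
Proof.
move=> z_prim; apply/eqP.
rewrite -(@pexpr_eq1 _ _ n) ?(prim_order_gt0 z_prim) //.
by rewrite -normrX prim_expr_order // normr1.
Qed.

(** * The exponential on the imaginary axis, and exponentials of diagonalised matrices *)

Section Expi.
Variable R : realType.

Definition expi (x : R) : Cplx R := Complex (cos x) (sin x).

Lemma expiD x y : expi (x + y) = expi x * expi y.
Proof.
apply/eqP; rewrite eq_complex /= cosD sinD eqxx /=.
by rewrite addrC.
Qed.

Lemma expi0 : expi 0 = 1.
Proof. by rewrite /expi cos0 sin0. Qed.

Lemma real_complex_continuous : continuous (fun x : R => (x%:C)%C : Cplx R).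
Proof.
move=> x; apply/cvgrPdist_lt => /= e e_gt0.
(* In the order on [Cplx R] a positive element is real, so the radius [e] reduces to a real one. *)
have e_real : ((complex.Re e)%:C)%C = e by apply: RRe_real; exact: gtr0_real.
have e'_gt0 : 0 < complex.Re e by rewrite -ltcR e_real.
near=> y.
rewrite -rmorphB normc_def /= expr0n /= addr0 sqrtr_sqr -[e]e_real ltcR.
by near: y; exact: cvgr_dist_lt.
Unshelve. all: by end_near. Qed.

(** Euler's formula term by term: the parity of [k] decides whether the power of ['i] is real or
    imaginary, and this parity is already a factor of [cos_coeff] and [sin_coeff]. *)
Lemma exp_coeff_cos_sin (x : R) k :
  (k`!%:R : Cplx R)^-1 * ('i%C * (x%:C)%C) ^+ k =
  ((cos_coeff x k)%:C)%C + 'i%C * ((sin_coeff x k)%:C)%C.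
Proof.
rewrite /cos_coeff /sin_coeff /= exprMn -rmorphXn.
rewrite -(rmorph_nat (real_complex R)) -fmorphV.
have -> : ('i%C : Cplx R) ^+ k =
    (((~~ odd k)%:R * (-1) ^+ k./2)%:C)%C +
    'i%C * (((odd k)%:R * (-1) ^+ k.-1./2)%:C)%C.
  rewrite -[in LHS](odd_double_half k) exprD -mul2n exprM sqr_i.
  have -> : ((-1) ^+ k./2 : Cplx R) = (((-1) ^+ k./2)%:C)%C.
    by rewrite rmorphXn rmorphN rmorph1.
  case: (boolP (odd k)) => k_odd /=.
    have -> : (k.-1./2 = k./2)%N.
      move: k_odd; case: k => //= k /negbTE k_even.
      by rewrite uphalf_half k_even.
    by rewrite !mul1r mul0r rmorph0 add0r expr1.
  by rewrite !mul1r mul0r rmorph0 mulr0 addr0.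
rewrite !rmorphM /=; ring.
Qed.

Lemma cvg_series_expi (x : R) :
  series (fun k : nat => (k`!%:R : Cplx R)^-1 * ('i%C * (x%:C)%C) ^+ k) @ \oo
  --> expi x.
Proof.
have -> : series (fun k : nat => (k`!%:R : Cplx R)^-1 *
      ('i%C * (x%:C)%C) ^+ k) =
    (fun k => ((series (cos_coeff x) k)%:C)%C +
      'i%C * ((series (sin_coeff x) k)%:C)%C).
  apply/funext => k; rewrite /series /= !rmorph_sum /= mulr_sumr -big_split /=.
  by apply: eq_bigr => i _; exact: exp_coeff_cos_sin.
have -> : expi x = ((cos x)%:C)%C + 'i%C * ((sin x)%:C)%C.
  exact: (complexE (expi x)).
apply: cvgD; last apply: cvgM; first last.
- apply: (@continuous_cvg _ _ _ _ _ _ (fun x : R => (x%:C)%C : Cplx R)).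
    exact: real_complex_continuous.
  by rewrite sin.unlock; exact: is_cvg_series_sin_coeff.
- exact: cvg_cst.
- apply: (@continuous_cvg _ _ _ _ _ _ (fun x : R => (x%:C)%C : Cplx R)).
    exact: real_complex_continuous.
  by rewrite cos.unlock; exact: is_cvg_series_cos_coeff.
Qed.

(** Multiplying [\sum_i E i = 1] repeatedly by [A] gives [A ^+ k = \sum_i l i ^+ k *: E i], so the
    matrix series is a finite combination of scalar series. *)
Lemma expmx_spectral n (I : finType) (A : 'M[Cplx R]_n.+1)
    (E : I -> 'M[Cplx R]_n.+1) (l e : I -> Cplx R) :
  \sum_i E i = 1 -> (forall i, E i *m A = l i *: E i) ->
  (forall i, series (fun k : nat => (k`!%:R)^-1 * l i ^+ k) @ \oo --> e i) ->
  expmx A = \sum_i e i *: E i.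
Proof.
move=> sumE EA cvg_e; apply: cvg_lim; first exact: norm_hausdorff.
have powA k : A ^+ k = \sum_i l i ^+ k *: E i.
  elim: k => [|k IHk]; first by under eq_bigr do rewrite expr0 scale1r.
  rewrite exprSr IHk mulr_suml; apply: eq_bigr => i _.
  by rewrite -scalerAl -[E i * A]/(E i *m A) EA scalerA -exprSr.
have -> : series (fun k : nat => (k`!%:R : Cplx R)^-1 *: A ^+ k) =
    (fun k => \sum_i (series (fun k : nat => (k`!%:R)^-1 * l i ^+ k) k) *: E i).
  apply/funext => k; rewrite /series /=.
  under [RHS]eq_bigr do rewrite scaler_suml.
  rewrite exchange_big /=; apply: eq_bigr => j _.
  by rewrite powA scaler_sumr; apply: eq_bigr => i _; rewrite scalerA.
apply: cvg_big; first exact: add_continuous.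
by move=> i _; exact: cvgZr_tmp.
Qed.

End Expi.

(** * Characters of the cyclic group of order [N.+2] *)

Section Circulant.
Variables (R : realType) (N : nat) (z : Cplx R).
Hypothesis z_prim : N.+2.-primitive_root z.
Implicit Types (j l x y v : 'I_N.+2).

(** The exponent is a product of representatives in [nat]; it matters only modulo [N.+2], the order
    of [z]. *)
Definition chi j x : Cplx R := z ^+ (j * x)%N.

Lemma chiC j x : chi j x = chi x j.
Proof. by rewrite /chi mulnC. Qed.

Lemma chiDr j x y : chi j (x + y) = chi j x * chi j y.
Proof.
rewrite /chi -exprD -mulnDr; apply/eqP.
by rewrite (eq_prim_root_expr z_prim) modnMmr.
Qed.

Lemma chiDl j l x : chi (j + l) x = chi j x * chi l x.
Proof. by rewrite chiC chiDr !(chiC x). Qed.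

Lemma chi0r j : chi j 0 = 1.
Proof. by rewrite /chi muln0. Qed.

Lemma chi0l x : chi 0 x = 1.
Proof. by rewrite chiC chi0r. Qed.

Lemma chi_neq0 j x : chi j x != 0.
Proof. by rewrite -normr_gt0 normrX (norm_prim_root z_prim) expr1n ltr01. Qed.

Lemma chiNr j x : chi j (- x) = (chi j x)^-1.
Proof.
apply: (mulfI (chi_neq0 j x)).
by rewrite -chiDr subrr chi0r divff // chi_neq0.
Qed.

Lemma chiNl j x : chi (- j) x = (chi j x)^-1.
Proof. by rewrite chiC chiNr chiC. Qed.

Lemma chi1l x : (chi 1 x == 1) = (x == 0).
Proof.
rewrite /chi mul1n -(expr0 z) (eq_prim_root_expr z_prim) mod0n.
by rewrite modn_small.
Qed.

Lemma chiMnl j x r : chi (j *+ r) x = chi j x ^+ r.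
Proof.
by elim: r => [|r IHr]; rewrite ?mulr0n ?chi0l // mulrS chiDl IHr exprS.
Qed.

Lemma chi_nat (i j : nat) : chi i%:R j%:R = z ^+ (i * j).
Proof.
by rewrite chiMnl chiC chiMnl mulnC exprM /chi mul1n expr1.
Qed.

Lemma conj_chi j x : (chi j x)^* = chi j (- x).
Proof.
rewrite chiNr invC_norm normrX (norm_prim_root z_prim).
by rewrite !expr1n invr1 mul1r.
Qed.

Lemma sum_chi x : \sum_j chi j x = if x == 0 then N.+2%:R else 0.
Proof.
have [->|x_neq0] := eqVneq x 0.
  by under eq_bigr do rewrite chi0r; rewrite sumr_const card_ord.
(* A geometric sum of ratio [chi 1 x], whose power [N.+2] is 1. *)
have : (chi 1 x - 1) * \sum_j chi j x = 0.
  under eq_bigr => j _ do rewrite /chi mulnC exprM.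
  rewrite /chi mul1n -subrX1 -exprM mulnC exprM (prim_expr_order z_prim) expr1n.
  by rewrite subrr.
by move/eqP; rewrite mulf_eq0 subr_eq0 chi1l (negPf x_neq0) => /eqP.
Qed.

(** * Eigenvalues and spectral decomposition of the circulant graph *)

Variable S : {set 'Z_N.+2}.
Hypothesis zero_notin_S : 0 \notin S.
Hypothesis S_opp : forall d, d \in S -> - d \in S.

Definition lam j : Cplx R := \sum_(d in S) chi j d.

Lemma lamN j : lam (- j) = lam j.
Proof.
rewrite /lam (reindex_inj (@oppr_inj _)) /=.
apply: eq_big => [d|d _]; last by rewrite chiNl chiNr invrK.
by apply/idP/idP => /S_opp; rewrite ?opprK.
Qed.

Lemma lam_real j : lam j \is Num.real.
Proof.
rewrite CrealE /lam rmorph_sum /= (reindex_inj (@oppr_inj _)) /=.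
apply/eqP; apply: eq_big => [d|d _]; last by rewrite conj_chi opprK.
by apply/idP/idP => /S_opp; rewrite ?opprK.
Qed.

Definition mu j : R := complex.Re (lam j).

Lemma muE j : lam j = ((mu j)%:C)%C.
Proof. by rewrite /mu RRe_real // lam_real. Qed.

(** The orthogonal projection onto the line spanned by the vector with entries [chi j x]. *)
Definition spectral_proj j : 'M[Cplx R]_N.+2 :=
  \matrix_(x, y) (chi j (x - y) / N.+2%:R).

Lemma order_neq0 : N.+2%:R != 0 :> Cplx R.
Proof. by rewrite pnatr_eq0. Qed.

Lemma sum_spectral_proj : \sum_j spectral_proj j = 1.
Proof.
apply/matrixP => x y; rewrite summxE mxE.
under eq_bigr do rewrite mxE.
rewrite -mulr_suml sum_chi subr_eq0; case: eqP => _; last by rewrite mul0r.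
by rewrite divff ?order_neq0.
Qed.

Lemma spectral_proj_adj j :
  spectral_proj j *m adjmx R (circulant S) = lam j *: spectral_proj j.
Proof.
apply/matrixP => x y; rewrite !mxE.
(* The middle vertex is written [y - d], so that [d] is the step along the edge to [y]. *)
rewrite (reindex_inj (inj_comp (@addrI _ y) (@oppr_inj _))) /=.
rewrite /lam mulr_suml [RHS]big_mkcond /=; apply: eq_bigr => d _.
rewrite !mxE /circulant subKr.
have [dS|dS] := boolP (d \in S); last by rewrite andbF mulr0.
rewrite andbT.
have -> : y - d != y.
  rewrite -subr_eq0 addrAC subrr add0r oppr_eq0.
  by apply: contraNneq zero_notin_S => <-.
by rewrite mulr1 opprB addrCA (chiDr j d) mulrA.
Qed.

Lemma transition_circulant t :
  transition_mx (circulant S) t =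
  \sum_j expi (- (t * mu j)) *: spectral_proj j.
Proof.
apply: (@expmx_spectral _ _ _ _ _
  (fun j => 'i%C * ((- (t * mu j))%:C)%C)) => [||j].
- exact: sum_spectral_proj.
- move=> j; rewrite -scalemxAr spectral_proj_adj scalerA muE.
  by rewrite rmorphN rmorphM mulrN mulNr mulrA.
- exact: cvg_series_expi.
Qed.

(** * The unnormalised Fourier transform, which diagonalises the evolution *)

Definition fourier l (u : 'cV[Cplx R]_N.+2) : Cplx R :=
  \sum_y chi l (- y) * u y 0.

Lemma fourier_vertex l v : fourier l (vertex_vec R v) = chi l (- v).
Proof.
rewrite /fourier (bigD1 v) //= mxE !eqxx mulr1 big1 ?addr0 // => y y_neq.
by rewrite mxE (negPf y_neq) mulr0.
Qed.

Lemma fourierD l u w : fourier l (u + w) = fourier l u + fourier l w.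
Proof.
by rewrite /fourier -big_split; apply: eq_bigr => y _; rewrite mxE mulrDr.
Qed.

Lemma fourierZ l c u : fourier l (c *: u) = c * fourier l u.
Proof.
by rewrite /fourier mulr_sumr; apply: eq_bigr => y _; rewrite mxE mulrCA.
Qed.

Lemma fourier_sum l (I : finType) (u : I -> 'cV[Cplx R]_N.+2) :
  fourier l (\sum_i u i) = \sum_i fourier l (u i).
Proof.
apply: (big_morph (fourier l)); first exact: fourierD.
by rewrite /fourier big1 // => y _; rewrite mxE mulr0.
Qed.

Lemma fourier_continuous l : continuous (fourier l).
Proof.
move=> u; apply: (@cvg_big _ _ _ _ _ _ _ (nbhs u)) => [|y _].
  exact: add_continuous.
by apply: (@cvgM _ _ (nbhs u)); [exact: cvg_cst | exact: coord_continuous].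
Qed.

Lemma fourier_spectral_proj l j v :
  fourier l (spectral_proj j *m vertex_vec R v) =
  if j == l then chi l (- v) else 0.
Proof.
rewrite /fourier -colE.
under eq_bigr => y _.
  rewrite !mxE chiDr mulrA mulrA.
  rewrite (chiNr l) -chiNl -chiDl (chiC _ y) -mulrA; over.
rewrite -mulr_suml sum_chi (addrC (- l)) subr_eq0.
case: eqP => [->|_]; last by rewrite mul0r.
by rewrite mulrCA divff ?order_neq0 // mulr1.
Qed.

Lemma fourier_transition t l v :
  fourier l (transition_mx (circulant S) t *m vertex_vec R v) =
  expi (- (t * mu l)) * chi l (- v).
Proof.
rewrite transition_circulant mulmx_suml fourier_sum (bigD1 l) //=.
rewrite -scalemxAl fourierZ fourier_spectral_proj eqxx.
rewrite big1 ?addr0 // => j j_neq.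
by rewrite -scalemxAl fourierZ fourier_spectral_proj (negPf j_neq) mulr0.
Qed.

(** * Limits of the phases along the time sequence *)

Section PGFR.
Variables (a b : 'I_N.+2) (t : nat -> R) (alpha beta : Cplx R).
Hypothesis cvg_transition :
  (fun k : nat => transition_mx (circulant S) (t k) *m vertex_vec R a) @ \oo
  --> alpha *: vertex_vec R a + beta *: vertex_vec R b.

Definition phase l : Cplx R := alpha + beta * chi l (a - b).

(** The Fourier coefficient at [l] of the convergent vectors, multiplied by [chi l a] to cancel the
    factor [chi l (- a)] of the initial state. *)
Lemma cvg_phase l : (fun k => expi (- (t k * mu l))) @ \oo --> phase l.
Proof.
have cvg_l := continuous_cvg _ (@fourier_continuous l _) cvg_transition.
have -> : (fun k => expi (- (t k * mu l))) =
    (fun k => fourier l (transition_mx (circulant S) (t k) *m vertex_vec R a)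
                * chi l a).
  apply/funext => k.
  by rewrite fourier_transition -mulrA -chiDr addNr chi0r mulr1.
have -> : phase l = fourier l (alpha *: vertex_vec R a + beta *: vertex_vec R b)
    * chi l a.
  rewrite fourierD !fourierZ !fourier_vertex mulrDl -!mulrA -!chiDr addNr chi0r.
  by rewrite mulr1 (addrC (- b)).
by apply: cvgM; [exact: cvg_l | exact: cvg_cst].
Qed.

Lemma phase_eq j l : lam j = lam l -> phase j = phase l.
Proof.
move=> eq_lam; have mu_eq : mu j = mu l by rewrite /mu eq_lam.
apply: (cvg_unique _ (@cvg_phase j)); first exact: norm_hausdorff.
by rewrite mu_eq; exact: cvg_phase.
Qed.

(* [lam] is real, so an additive relation between eigenvalues makes the product
   of the phases identically 1 along the sequence. *)
Lemma prod_phase (I : finType) (f : I -> 'I_N.+2) :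
  \sum_i lam (f i) = 0 -> \prod_i phase (f i) = 1.
Proof.
move=> sum0; have sum_mu : \sum_i mu (f i) = 0.
  apply: (@complexI R); rewrite rmorph_sum rmorph0 -[RHS]sum0 /=.
  by apply: eq_bigr => i _; rewrite muE.
have cvg_prod : (fun k => \prod_i expi (- (t k * mu (f i)))) @ \oo -->
    \prod_i phase (f i).
  by apply: cvg_big => [|i _]; [exact: mul_continuous | exact: cvg_phase].
apply: (cvg_unique _ cvg_prod); first exact: norm_hausdorff.
under [X in X @ _]eq_fun => k.
  rewrite -(big_morph (@expi R) (@expiD R) (@expi0 R)) sumrN -mulr_sumr sum_mu.
  rewrite mulr0 oppr0 expi0; over.
exact: cvg_cst.
Qed.

End PGFR.

(* The factors [*+ 2] make [half] and [q] trivial on the element [a - b] of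
   order 2. *)
Lemma circulant_no_PGFR (half q : 'I_N.+2) (M : nat) :
  odd M ->
  (forall d, d \in S -> chi (half *+ 2) d = -1) ->
  (forall d, d \in S -> chi (q *+ 2) d != 1 /\ chi (q *+ 2) d ^+ M = 1) ->
  ~ PGFR R (circulant S).
Proof.
move=> M_odd S_half S_q [a [b [a_neq_b]]].
move=> [t [alpha [beta [beta_neq0 _ cvg_t]]]].
pose v := a - b; pose g := phase a b alpha beta.
have v2 : v *+ 2 = 0.
  (* Cancelling [alpha] and [beta] makes [chi 1 v] equal to its inverse, and [chi 1] is faithful. *)
  have : g 1 = g (- 1) by apply: (phase_eq cvg_t); rewrite lamN.
  move/addrI/(mulfI beta_neq0)/eqP; rewrite chiNl -chiNr -subr_eq0.
  rewrite subr_eq0 -(inj_eq (mulIf (chi_neq0 1 v))) -!chiDr addNr chi0r chi1l.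
  by move/eqP.
have g_add j l : g (l + j *+ 2) = g l.
  by rewrite /g /phase chiDl chiMnl (chiC j) -chiMnl v2 chi0l mulr1.
(* [g 1 = g 0] would force [chi 1 v = 1], that is [a = b]. *)
suff g1 l : g l = 1.
  have : beta * (chi 1 v - 1) = 0.
    rewrite mulrBr mulr1 -[X in _ - X](mulr1 beta) -(chi0l v).
    by rewrite -[RHS](subrr 1) -{1}(g1 1) -(g1 0) /g /phase; ring.
  move/eqP; rewrite mulf_eq0 (negPf beta_neq0) subr_eq0 chi1l subr_eq0.
  by rewrite (negPf a_neq_b).
have sqr_g : g l ^+ 2 = 1.
  rewrite -[RHS](prod_phase cvg_t (f := fun i : bool =>
    if i then l else l + half *+ 2)).
    by rewrite big_bool /= -!/(g _) g_add.
  rewrite big_bool /= /lam -big_split big1 //= => d /S_half chid.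
  by rewrite chiDl chid mulrN1 subrr.
have gM : g l ^+ M = 1.
  rewrite -[RHS](prod_phase cvg_t (f := fun r : 'I_M => l + q *+ r *+ 2)).
    under eq_bigr do rewrite -/(g _) g_add.
    by rewrite prodr_const card_ord.
  rewrite /lam exchange_big big1 //= => d /S_q[chid_neq1 chidM].
  under eq_bigr do rewrite chiDl mulrnAC chiMnl.
  rewrite -mulr_sumr.
  (* The ratio is an [M]-th root of unity other than 1, so the geometric sum vanishes. *)
  suff -> : \sum_(r < M) chi (q *+ 2) d ^+ r = 0 by rewrite mulr0.
  apply: (mulfI (x := chi (q *+ 2) d - 1)); first by rewrite subr_eq0.
  by rewrite -subrX1 chidM subrr mulr0.
(* As [M] is odd and [g l ^+ 2 = 1], the power [g l ^+ M] is [g l] itself. *)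
by rewrite -gM -(odd_double_half M) M_odd exprD -mul2n exprM sqr_g expr1n mulr1.
Qed.

End Circulant.

Lemma mem_prime_power_connection_set N p m (k : 'I_m.+1 -> nat) (d : 'Z_N.+2) :
  (forall i, p ^ k i <= N.+2)%N ->
  d \in prime_power_connection_set N.+2 p k <->
  exists i, d = (p ^ k i)%:R \/ d = - (p ^ k i)%:R.
Proof.
(* The bound [le_pk] keeps the truncated subtraction exact. *)
move=> le_pk; have subE i : ((N.+2 - p ^ k i)%N%:R : 'Z_N.+2) = - (p ^ k i)%:R.
  by rewrite natrB // pchar_Zp // sub0r.
rewrite inE; split=> [/orP[] /imsetP[i _ ->]|[i [->|->]]].
- by exists i; left.
- by exists i; right; rewrite subE.
- by apply/orP; left; apply/imsetP; exists i.
- by apply/orP; right; apply/imsetP; exists i; rewrite ?subE.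
Qed.

Theorem theorem4p16 (R : realType) (n p h s m : nat) (k : 'I_m.+1 -> nat)
    (p_prime : prime p) (p_odd : odd p)
    (h_gt1 : (1 < h)%N) (s_gt0 : (0 < s)%N)
    (n_def : n = (2 ^ h * p ^ s)%N)
    (k_0 : k ord0 = 0%N)
    (k_increasing : forall i j : 'I_m.+1, (i < j)%N -> (k i < k j)%N)
    (k_lt_s : (k ord_max < s)%N) :
  ~ PGFR R (circulant (prime_power_connection_set n p k)).
Proof.
have k_lt i : (k i < s)%N.
  apply: leq_ltn_trans k_lt_s; have [->//|i_neq] := eqVneq i ord_max.
  by apply/ltnW/k_increasing; rewrite ltn_neqAle i_neq -ltnS /=.
(* From here on the exponent of 2 in [n] is [h.+2]. *)
case: h h_gt1 n_def => [|[|h]] // _ n_def.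
have p_gt0 : (0 < p)%N := prime_gt0 p_prime.
have [N nE] : exists N, n = N.+2.
  suff : (1 < n)%N by case: n {n_def} => [|[|N]] //; exists N.
  by rewrite n_def expnS -mulnA (@leq_mul 2 1) // muln_gt0 !expn_gt0 p_gt0.
rewrite {}nE in n_def *.
have le_pk i : (p ^ k i <= N.+2)%N.
  rewrite n_def -[leqLHS]mul1n leq_mul ?expn_gt0 // leq_exp2l ?prime_gt1 //.
  exact: ltnW.
have [z z_prim] := @prim_root_exists (Cplx R) N.+2 isT.
(* [half] stands for [n / 4], an integer because 4 divides [n]; doubling gives the shifts [n / 2]
   and [2 ^ h.+2]. *)
pose half : 'I_N.+2 := (2 ^ h * p ^ s)%:R; pose q : 'I_N.+2 := (2 ^ h.+1)%:R.
have half2 : half *+ 2 = (2 ^ h.+1 * p ^ s)%:R.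
  by rewrite /half -mulrnA mulnAC -expnSr.
have q2 : q *+ 2 = (2 ^ h.+2)%:R by rewrite /q -mulrnA -expnSr.
have p_s_gt0 : (0 < p ^ s)%N by rewrite expn_gt0 p_gt0.
(* This power is a square root of 1, and differs from 1 since [z] has order [n]. *)
have z_half : z ^+ (2 ^ h.+1 * p ^ s) = -1.
  have /eqP : (z ^+ (2 ^ h.+1 * p ^ s)) ^+ 2 = 1.
    by rewrite -exprM mulnAC -expnSr -n_def prim_expr_order.
  rewrite sqrf_eq1 => /orP[|/eqP //].
  rewrite -(prim_order_dvd z_prim) n_def.
  by rewrite dvdn_pmul2r // dvdn_Pexp2l // ltnn.
have S_half d : d \in prime_power_connection_set N.+2 p k ->
    chi z (half *+ 2) d = -1.
  have pos i : chi z (half *+ 2) (p ^ k i)%:R = -1.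
    rewrite half2 (chi_nat z_prim) exprM z_half -signr_odd oddX p_odd orbT.
    by rewrite expr1.
  move/(mem_prime_power_connection_set _ le_pk) => [i [->|->]] //.
  by rewrite (chiNr z_prim) pos invrN invr1.
apply: (@circulant_no_PGFR _ _ _ z_prim _ _ _ half q (p ^ s)).
(* If 0 were in the set, [S_half] would give [1 = -1]. *)
- apply/negP => /S_half; rewrite chi0r => /eqP.
  by rewrite -subr_eq0 opprK -mulr2n pnatr_eq0.
- move=> d /(mem_prime_power_connection_set _ le_pk) [i d_eq].
  apply/(mem_prime_power_connection_set _ le_pk); exists i.
  by case: d_eq => ->; rewrite ?opprK; [right | left].
- by rewrite oddX p_odd orbT.
- exact: S_half.
(* The value is [z ^+ (2 ^ h.+2 * p ^ k i)]: [n] does not divide this exponent as [k i < s], but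
   divides it once multiplied by [p ^ s]. *)
- have pos i : chi z (q *+ 2) (p ^ k i)%:R != 1 /\
      chi z (q *+ 2) (p ^ k i)%:R ^+ (p ^ s) = 1.
    rewrite q2 (chi_nat z_prim); split.
      rewrite -(prim_order_dvd z_prim) n_def dvdn_pmul2l ?expn_gt0 //.
      by rewrite dvdn_Pexp2l ?prime_gt1 // -ltnNge.
    by rewrite -exprM mulnAC -n_def exprM (prim_expr_order z_prim) expr1n.
  move=> d /(mem_prime_power_connection_set _ le_pk) [i [->|->]] //.
  rewrite (chiNr z_prim) exprVn (pos i).2 invr1; split=> //.
  by rewrite invr_eq1 (pos i).1.
Qed.
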